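(* The puzzle graphs of the following boards with exactly two holes have the strong parity property: (1) the flower $F(m)$ for $m\ge 3$; (2) the trimmed triangle $T^{tr}(m)$ for $m\ge 5$; (3) the trimmed parallelogram $P^{tr}(m_1,m_2)$ where $m_1,m_2\ge 3$ and $\max\{m_1,m_2\}\ge 4$.
   Context: Hexagons of the regular hexagonal tessellation of the plane are identified with points of $\mathbb{Z}^2$; two hexagons are adjacent (share an edge) iff their difference is one of $\pm(1,0),\pm(0,1),\pm(1,1)$. A board $B$ is a finite set of hexagons (positions). Families of boards: parallelogram $P(m_1,m_2)=\{0,\dots,m_1-1\}\times\{0,\dots,m_2-1\}$; triangle with $m$ hexagons on a side $T(m)=\{(i,j): 0\le j\le i\le m-1\}$; flower with $m$ layers $F(m)=\{(i,j):\max(|i|,|j|,|i-j|)\le m-1\}$. A tight corner of a board is a hexagon of the board with exactly two neighbors in the board, which are adjacent to each other; $P^{tr}(m_1,m_2)$ and $T^{tr}(m)$ are obtained from $P(m_1,m_2)$ and $T(m)$ by removing all tight corners, i.e. removing $(m_1-1,0),(0,m_2-1)$, resp. $(0,0),(m-1,0),(m-1,m-1)$. $B(h)$ denotes the board $B$ with $h$ holes: a configuration of $B(h)$ is a placement of $t=|B|-h$ tiles with distinct labels $1,\dots,t$ on distinct positions of $B$; the $h$ unoccupied positions are the holes (unlabeled; adjacent holes are counted separately). A slide moves a tile from its position $p$ to a hole $q$ adjacent to $p$, and is permitted iff there is another hole $r$ that is adjacent to both $p$ and $q$. The puzzle graph $puz[B(h)]$ has the configurations of $B(h)$ as vertices,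 with an edge between two configurations whenever one can be obtained from the other by one slide. A configuration is non-isolated if at least one slide is possible from it. $puz[B(h)]$ has the weak parity property if whenever two non-isolated configurations with the holes in the same positions are in the same connected component, one can be obtained from the other by an even permutation of the tiles. $puz[B(h)]$ has the strong parity property if it has the weak parity property and exactly two of its connected components contain non-isolated configurations (these two together containing all of them). *)

(* Defs.v *)
From mathcomp Require Import all_boot all_fingroup all_algebra.
From mathcomp Require Import finmap zify.

Set Implicit Arguments.
Unset Strict Implicit.
Unset Printing Implicit Defensive.

Import GRing.Theory Num.Theory.
Local Open Scope ring_scope.

Definition hexagon : Type := (int * int)%type.

Definition hex_dirs : seq hexagon :=
  [:: (1, 0); (0, 1); (1, 1); (-1, 0); (0, -1); (-1, -1)].

Definition hex_adj (x y : hexagon) : bool := y - x \in hex_dirs.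

Definition board : Type := {fset hexagon}.

Definition parallelogram (m1 m2 : nat) : board :=
  [fset ((i : nat)%:Z, (j : nat)%:Z) | i in iota 0 m1, j in iota 0 m2]%fset.

Definition triangle (m : nat) : board :=
  [fset x in parallelogram m m | x.2 <= x.1]%fset.

(* The outer comprehension only supplies a finite square containing
   max(|i|, |j|) <= m - 1. Here m - 1 is an integer, so flower 0 is empty. *)
Definition flower (m : nat) : board :=
  [fset x in [fset (y - (m%:Z, m%:Z) : hexagon)
             | y in parallelogram m.*2.+1 m.*2.+1]
  | Num.max (Num.max `|x.1| `|x.2|) `|x.1 - x.2| <= m%:Z - 1]%fset.

Lemma mem_parallelogram (m1 m2 : nat) (x : hexagon) :
  (x \in parallelogram m1 m2) =
  (0 <= x.1 <= m1%:Z - 1) && (0 <= x.2 <= m2%:Z - 1).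
Proof.
case: x => i j /=; apply/imfset2P/idP => [[a + [b + [-> ->]]]|ij_in].
  by rewrite !mem_iota; lia.
exists `|i|%N; first by rewrite mem_iota; lia.
by exists `|j|%N; [rewrite mem_iota | congr pair]; lia.
Qed.

Lemma mem_triangle (m : nat) (x : hexagon) :
  (x \in triangle m) = (0 <= x.2) && (x.2 <= x.1 <= m%:Z - 1).
Proof. by case: x => i j; rewrite !inE /= mem_parallelogram /=; lia. Qed.

Lemma mem_flower (m : nat) (x : hexagon) :
  (x \in flower m) =
  (Num.max (Num.max `|x.1| `|x.2|) `|x.1 - x.2| <= m%:Z - 1).
Proof.
case: x => i j; rewrite !inE /= andb_idl // => ij_in; apply/imfsetP.
exists ((i, j) + (m%:Z, m%:Z)); last by rewrite addrK.
by rewrite /= mem_parallelogram /=; lia.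
Qed.

Definition neighbors (B : board) (x : hexagon) : seq hexagon :=
  [seq y <- [seq x + d | d <- hex_dirs] | y \in B].

Definition tight_corner (B : board) (x : hexagon) : bool :=
  (x \in B) && (if neighbors B x is [:: y; z] then hex_adj y z else false).

Definition trim (B : board) : board :=
  [fset x in B | ~~ tight_corner B x]%fset.

Lemma hex_adjE (i j k l : int) :
  hex_adj (i, j) (k, l) =
  ((k - i, l - j) \in hex_dirs).
Proof. by []. Qed.

Lemma trim_parallelogram (m1 m2 : nat) : (1 < m1)%N -> (1 < m2)%N ->
  trim (parallelogram m1 m2) =
  (parallelogram m1 m2 `\` [fset (m1%:Z - 1, 0%:Z); (0%:Z, m2%:Z - 1)])%fset.
Proof.
move=> m1_gt1 m2_gt1; apply/fsetP => -[i j].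
rewrite !inE /= /tight_corner [LHS]andbC.
case: (boolP (_ \in parallelogram _ _)) => ij_in; last by rewrite !andbF.
move: ij_in; rewrite /neighbors /= !andbT !mem_parallelogram !xpair_eqE /=.
move=> ij_in.
by repeat (case: ifP => ?; try (exfalso; lia));
  rewrite ?hex_adjE /hex_dirs ?inE ?xpair_eqE /=; lia.
Qed.

Lemma trim_triangle (m : nat) : (1 < m)%N ->
  trim (triangle m) =
  (triangle m `\`
   [fset (0%:Z, 0%:Z); (m%:Z - 1, 0%:Z); (m%:Z - 1, m%:Z - 1)])%fset.
Proof.
move=> m_gt1; move: (triangle m) (mem_triangle m) => T memT.
apply/fsetP => -[i j].
rewrite !inE /= /tight_corner [LHS]andbC.
case: (boolP (_ \in T)) => ij_in; last by rewrite !andbF.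
move: ij_in; rewrite /neighbors /= !andbT !memT !xpair_eqE /=.
move=> ij_in.
by repeat (case: ifP => ?; try (exfalso; lia));
  rewrite ?hex_adjE /hex_dirs ?inE ?xpair_eqE /=; lia.
Qed.

Section Puzzle.
Variables (B : board) (h : nat).

(* Tiles are labeled 0, ..., |B| - h - 1. The subtraction is truncated, so this
   is meant for h <= |B|. *)
Definition tile : Type := 'I_(#|` B| - h).

Definition configuration : Type :=
  {c : {ffun tile -> B} | injectiveb c}.

Definition holes (c : configuration) : {set B} :=
  [set q | q \notin codom (val c)].

Definition slide (c c' : configuration) : bool :=
  [exists k : tile, exists q in holes c, exists r in holes c,
    [&& hex_adj (val (val c k)) (val q),
        r != q, hex_adj (val r) (val (val c k)), hex_adj (val r) (val q)
      & val c' == [ffun l => if l == k then q else val c l]]].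

Definition puz : rel configuration :=
  fun c c' => slide c c' || slide c' c.

Definition non_isolated (c : configuration) : bool := [exists c', slide c c'].

Definition weak_parity : Prop :=
  forall c c' : configuration,
    non_isolated c -> non_isolated c' -> holes c = holes c' ->
    connect puz c c' ->
    exists2 s : {perm tile}, ~~ odd_perm s & forall k, val c' k = val c (s k).

Definition components : {set {set configuration}} :=
  equivalence_partition (connect puz) [set: configuration].

Definition strong_parity : Prop :=
  weak_parity /\
  #|[set C in components | [exists c in C, non_isolated c]]| = 2%N.

End Puzzle.

(* Main.v *)
Require Import Defs.
From mathcomp Require Import all_boot all_fingroup all_algebra.
From mathcomp Require Import finmap zify.

(** Parity. With two holes a slide needs both holes and the moving tile to form
    a triangle of mutually adjacent hexagons. Each triangle of the lattice has
    the cyclic orientation whose steps are [(1, 0)], [(0, 1)] and [(-1, -1)], and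
    the two triangles on an edge give it the same direction. So the two holes can
    be named canonically: the first is the tail of the edge that they occupy and
    the second its head. A slide is then a 3-cycle of the tile and the two named
    holes, hence an even permutation of the contents of the board
    ([slide_even]); if the holes return to their initial positions, so do the
    named holes, and the tiles undergo an even permutation. This gives the weak
    parity property for every board ([weak_parity2]).

    Connectivity. Call a hexagon interior if its six neighbors are in the board.
    One hole can rest at an interior hexagon [w] while the other one turns around
    it, which permutes five tiles cyclically. For two adjacent interior hexagons,
    with the holes on both, the two turns generate the alternating group of the
    eight tiles around them ([full_double_wheel]). Moving the holes along a
    path of interior hexagons conjugates these groups into permutations performed
    from a single position of the holes, and alternating groups whose supports
    share two points generate the alternating group of the union ([fullU]). Hence
    if the interior hexagons are connected, at least two, dominate the board, and
    meet each of its triangles, then all even permutations of the tiles are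
    performed from one fixed hole position, which every non-isolated
    configuration can reach. Exactly two components remain, told apart by parity
    ([strong_parity2]).

    The boards. Each of the three families consists of lattice hexagons
    [a <= i <= b], [c <= j <= d], [e <= i - j <= f], all six sides of which have
    at least two positions: trimming the tight corners removes precisely the
    sides with a single position. The interior is the region obtained by
    tightening all six inequalities by one. It is geodesically convex, and the
    conditions above reduce to linear arithmetic ([strong_parity_region]). *)

Set Implicit Arguments.
Unset Strict Implicit.
Unset Printing Implicit Defensive.

(** * Generating alternating groups *)

Section AlternatingGroups.
Local Open Scope group_scope.
Variable T : finType.
Implicit Types (G : {group {perm T}}) (X : {set T}) (s : {perm T}) (a b x y : T).

Definition contains_alt G X : Prop :=
  forall s, perm_on X s -> ~~ odd_perm s -> s \in G.

(** The 3-cycle [(a b y)] when the three points are distinct. *)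
Definition cyc3 a b y : {perm T} := tperm a b * tperm a y.

Lemma odd_cyc3 a b y : a != b -> a != y -> odd_perm (cyc3 a b y) = false.
Proof. by move=> ab ay; rewrite odd_permM !odd_tperm ab ay. Qed.

Lemma perm_on_sub X (Y : {set T}) s : X \subset Y -> perm_on X s -> perm_on Y s.
Proof. by move=> sXY sX; apply: subset_trans sXY. Qed.

Lemma perm_on_tperm X x y : x \in X -> y \in X -> perm_on X (tperm x y).
Proof.
by move=> xX yX; apply: perm_on_sub (tperm_on x y); rewrite subUset !sub1set xX.
Qed.

Lemma perm_on_cyc3 X a b y :
  a \in X -> b \in X -> y \in X -> perm_on X (cyc3 a b y).
Proof. by move=> aX bX yX; apply: perm_onM; apply: perm_on_tperm. Qed.

Lemma even_perm_on2 a b s :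
  perm_on [set a; b] s -> ~~ odd_perm s -> s = 1.
Proof.
move=> s_on s_even; have [sa|sa] := eqVneq (s a) a.
  apply: (@perm_on_id _ _ [set b]); last by rewrite cards1.
  apply/subsetP=> x; rewrite !inE => sx.
  have := subsetP s_on x; rewrite !inE => /(_ sx) /orP[/eqP xa|//].
  by rewrite xa sa eqxx in sx.
have sab : s a = b.
  by have := perm_closed a s_on; rewrite !inE eqxx (negPf sa) => /eqP.
have ab : a != b by rewrite -sab eq_sym.
have sba : s b = a.
  have := perm_closed b s_on; rewrite !inE eqxx orbT => /orP[/eqP//|/eqP sb].
  by case/eqP: ab; apply: (@perm_inj _ s); rewrite sab sb.
suff s_tp : s = tperm a b by rewrite s_tp odd_tperm ab in s_even.
apply/permP=> x; case: tpermP => [->|->|xa xb] //.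
apply: (out_perm s_on); rewrite !inE; apply/norP; split; exact/eqP.
Qed.

(** The 3-cycles through two fixed points generate the alternating group. By
    induction on the support: an even permutation is composed with an even
    product of such cycles that sends the image of a chosen third point [y]
    back to [y]. *)
Lemma contains_alt_cyc3 G X a b : a != b -> a \in X -> b \in X ->
    (forall y, y \in X -> y != a -> y != b -> cyc3 a b y \in G) ->
  contains_alt G X.
Proof.
move=> ab; have [n] := ubnP #|X|; elim: n X => // n IHn X ltXn aX bX cG s sX s_even.
have [/exists_inP[y yX /andP[ya yb]]|none] :=
    boolP [exists (y | y \in X), (y != a) && (y != b)]; last first.
  (* Only [a] and [b] are left, and the transposition of these two is odd. *)
  suff -> : s = 1 by rewrite group1.
  apply: (@even_perm_on2 a b) => //; apply: perm_on_sub sX; apply/subsetP=> x xX.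
  rewrite !inE; apply: contraNT none => /norP[xa xb].
  by apply/exists_inP; exists x; rewrite ?xa.
have cy x : cyc3 a b x b = x by rewrite permM tpermR tpermL.
have cVy x : x != a -> x != b -> (cyc3 a b x)^-1 a = x.
  move=> xa xb; apply: (canLR (permK _)).
  by rewrite permM [tperm a b x]tpermD ?tpermR // eq_sym.
have c_even x : x != a -> ~~ odd_perm (cyc3 a b x).
  by move=> xa; rewrite odd_cyc3 // eq_sym.
have [g [gG gX g_even gsy]] :
    exists g, [/\ g \in G, perm_on X g, ~~ odd_perm g & g (s y) = y].
  have [sy|sy] := eqVneq (s y) y.
    by exists 1; rewrite group1 perm_on1 odd_perm1 perm1.
  have cyX := perm_on_cyc3 aX bX yX.
  have [sya|sya] := eqVneq (s y) a.
    exists (cyc3 a b y)^-1.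
    by rewrite groupV cG // perm_onV // odd_permV c_even // sya cVy.
  have [syb|syb] := eqVneq (s y) b.
    by exists (cyc3 a b y); rewrite cG // c_even // syb cy.
  have xX : s y \in X by rewrite perm_closed.
  exists (cyc3 a b (s y) * (cyc3 a b y)^-1); split.
  - by rewrite groupM ?groupV ?cG.
  - by apply: perm_onM; [exact: perm_on_cyc3|exact: perm_onV].
  - by rewrite odd_permM odd_permV (negPf (c_even _ _)) // (negPf (c_even _ _)).
  - by rewrite permM [cyc3 _ _ _ _]permM [tperm a b _]tpermD ?tpermR ?cVy // eq_sym.
suff : s * g \in G by rewrite groupMr.
apply: (IHn (X :\ y)).
- by rewrite (cardsD1 y) yX in ltXn.
- by rewrite !inE eq_sym ya.
- by rewrite !inE eq_sym yb.
- by move=> x /setD1P[_ xX]; apply: cG.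
- apply/subsetP=> x; rewrite !inE => sgx; apply/andP; split.
    by apply: contraNneq sgx => ->; rewrite permM gsy.
  by have := subsetP (perm_onM sX gX) x; apply; rewrite !inE.
- by rewrite odd_permM (negPf s_even) (negPf g_even).
Qed.

(** * Products of transpositions of labelled points *)

(** The transpositions act from left to right, as products of permutations do. *)
Definition swaps (f : nat -> T) (l : seq (nat * nat)) : {perm T} :=
  \prod_(ij <- l) tperm (f ij.1) (f ij.2).

Definition eval_swaps (l : seq (nat * nat)) (k : nat) : nat :=
  foldl (fun k ij => if k == ij.1 then ij.2 else
                     if k == ij.2 then ij.1 else k) k l.

Definition swaps_below (n : nat) : pred (seq (nat * nat)) :=
  all (fun ij => (ij.1 < n) && (ij.2 < n)).

Lemma swaps_cat f l1 l2 : swaps f (l1 ++ l2) = swaps f l1 * swaps f l2.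
Proof. by rewrite /swaps big_cat. Qed.

Lemma swaps_rev f l : swaps f (rev l) = (swaps f l)^-1.
Proof.
elim: l => [|ij l IHl]; first by rewrite /swaps big_nil invg1.
by rewrite rev_cons -cats1 swaps_cat IHl /swaps big_seq1 big_cons invMg tpermV.
Qed.

Lemma swapsE f n l k : {in gtn n &, injective f} -> swaps_below n l -> k < n ->
  swaps f l (f k) = f (eval_swaps l k).
Proof.
move=> f_inj; elim: l k => [|[i j] l IHl] k /=.
  by rewrite /swaps big_nil perm1.
move=> /andP[/andP[lt_in lt_jn] l_lt] lt_kn.
rewrite /swaps big_cons permM /= -[_ (tperm _ _ _)]/(swaps f l _).
have -> : tperm (f i) (f j) (f k) = f (if k == i then j else if k == j then i else k).
  have [->|ki] := eqVneq k i; first by rewrite tpermL.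
  have [->|kj] := eqVneq k j; first by rewrite tpermR.
  by rewrite tpermD // eq_sym (inj_in_eq f_inj).
by apply: IHl => //; case: ifP => // _; case: ifP.
Qed.

Lemma swaps_out f n l x : (forall k, k < n -> x != f k) -> swaps_below n l ->
  swaps f l x = x.
Proof.
move=> xf; elim: l => [|[i j] l IHl] /=; first by rewrite /swaps big_nil perm1.
move=> /andP[/andP[lt_in lt_jn] l_lt].
by rewrite /swaps big_cons permM tpermD ?IHl // eq_sym xf.
Qed.

(** Points enter such a product only through their labels, so that an identity
    between two products in an abstract type is decided by computing in [nat]. *)
Lemma eq_swaps f n l1 l2 : {in gtn n &, injective f} ->
    swaps_below n l1 -> swaps_below n l2 ->
    all (fun k => eval_swaps l1 k == eval_swaps l2 k) (iota 0 n) ->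
  swaps f l1 = swaps f l2.
Proof.
move=> f_inj lt1 lt2 /allP eq12; apply/permP=> x.
have [/existsP[k /eqP ->]|none] := boolP [exists k : 'I_n, x == f k].
  rewrite !(swapsE f_inj) //; congr f; apply/eqP.
  by apply: (eq12 k); rewrite mem_iota /=.
have xf k : k < n -> x != f k.
  by move=> lt_kn; apply: contraNneq none => ->; apply/existsP; exists (Ordinal lt_kn).
by rewrite !(swaps_out xf).
Qed.

End AlternatingGroups.

(** * Configurations, slides and hole movements *)

Section Moves.
Local Open Scope group_scope.
Variable B : board.
Implicit Types (c : configuration B 2) (s t : {perm B}) (p q r x y w : B).
Implicit Types (e X Y : {set B}).

Lemma permute_subproof c s : injectiveb [ffun k => s (val c k)].
Proof.
apply/injectiveP=> k l; rewrite !ffunE => /perm_inj.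
exact: (injectiveP _ (valP c)).
Qed.

(** Positions are permuted rather than tiles, so that permutations performed
    while the holes are in different places can be composed. *)
Definition permute c s : configuration B 2 :=
  exist (fun f : {ffun tile B 2 -> B} => injectiveb f) _ (permute_subproof c s).

Lemma permuteE c s k : val (permute c s) k = s (val c k).
Proof. by rewrite ffunE. Qed.

Lemma conf_eq c c' : (forall k, val c k = val c' k) -> c = c'.
Proof. by move=> cc'; apply/val_inj/ffunP. Qed.

Lemma permute1 c : permute c 1 = c.
Proof. by apply: conf_eq => k; rewrite permuteE perm1. Qed.

Lemma permuteM c s t : permute c (s * t) = permute (permute c s) t.
Proof. by apply: conf_eq => k; rewrite !permuteE permM. Qed.

Lemma holesPn c x : reflect (exists k, val c k = x) (x \notin holes c).
Proof.
rewrite inE negbK; apply: (iffP codomP) => -[k]; first by exists k.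
by move <-; exists k.
Qed.

Lemma holes_permute c s : holes (permute c s) = s @: holes c.
Proof.
apply/setP=> x; have -> : x = s (s^-1 x) by rewrite permKV.
rewrite mem_imset; last exact: perm_inj.
apply: negb_inj; apply/holesPn/holesPn => -[k ck]; exists k.
  by apply: (@perm_inj _ s); rewrite -permuteE.
by rewrite permuteE ck.
Qed.

Definition adj x y : bool := hex_adj (val x) (val y).

Lemma hex_adj_sym u v : hex_adj u v = hex_adj v u.
Proof.
rewrite /hex_adj -GRing.opprB; move: (v - u)%R => -[i j].
by rewrite !inE !xpair_eqE /=; lia.
Qed.

Lemma adj_sym x y : adj x y = adj y x.
Proof. exact: hex_adj_sym. Qed.

Lemma adj_neq x y : adj x y -> x != y.
Proof. by apply: contraTneq => ->; rewrite /adj /hex_adj GRing.subrr. Qed.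

(** Viewed on positions, a slide exchanges a tile with the hole that it enters, so
    it acts as a transposition. *)
Lemma slideP c c' : reflect
  (exists p q r, [/\ p \notin holes c, q \in holes c, r \in holes c,
     [/\ adj p q, adj r p & adj r q] & c' = permute c (tperm p q)])
  (slide c c').
Proof.
have move_tile k q : q \in holes c ->
    [ffun l => if l == k then q else val c l] = val (permute c (tperm (val c k) q)).
  move=> qc; apply/ffunP=> l; rewrite permuteE ffunE.
  have [->|lk] := eqVneq l k; first by rewrite tpermL.
  rewrite tpermD //.
    by rewrite (inj_eq (injectiveP _ (valP c))) eq_sym.
  by apply: contraTneq qc => ->; apply/holesPn; exists l.
apply: (iffP existsP) => [[k /exists_inP[q qc /exists_inP[r rc]]]|].
  case/and5P=> pq _ rp rq /eqP c'E; exists (val c k), q, r; split=> //.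
    by apply/holesPn; exists k.
  by apply: val_inj; rewrite c'E move_tile.
move=> [_ [q [r [/holesPn[k <-] qc rc [pq rp rq] ->]]]].
exists k; apply/exists_inP; exists q => //; apply/exists_inP; exists r => //.
by rewrite -/(adj _ _) pq -/(adj _ _) rp -/(adj _ _) rq (adj_neq rq) move_tile /=.
Qed.

Lemma slide_sym c c' : slide c c' -> slide c' c.
Proof.
case/slideP=> p [q [r [pc qc rc [pq rp rq] ->]]]; apply/slideP.
have imE x : (tperm p q x \in tperm p q @: holes c) = (x \in holes c).
  by rewrite mem_imset //; apply: perm_inj.
exists q, p, r; rewrite holes_permute; split.
- by have := imE p; rewrite tpermL => ->.
- by have := imE q; rewrite tpermR => ->.
- by have := imE r; rewrite tpermD ?rc // eq_sym adj_neq.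
- by rewrite adj_sym.
- by rewrite tpermC -permuteM tperm2 permute1.
Qed.

Lemma puzE c c' : puz c c' = slide c c'.
Proof. by apply/orP/idP => [[//|/slide_sym]|->]; [|left]. Qed.

Lemma connect_puz_sym : connect_sym (@puz B 2).
Proof. by apply: sym_connect_sym => c c'; rewrite /puz orbC. Qed.

(** * Hole movements and the permutations they perform *)

(** What a walk of the holes does to the positions does not depend on the labels
    of the tiles, so a single [s] serves all configurations with holes [e]. *)
Definition reach e s : bool :=
  [forall c : configuration B 2, (holes c == e) ==> connect (@puz B 2) c (permute c s)].

Lemma reachP e s :
  reflect (forall c, holes c = e -> connect (@puz B 2) c (permute c s)) (reach e s).
Proof.
apply: (iffP forall_inP) => re c; first by move=> ce; apply: re; apply/eqP.
by move/eqP; apply: re.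
Qed.

Lemma reach1 e : reach e 1.
Proof. by apply/reachP=> c _; rewrite permute1. Qed.

Lemma reachM e s t : reach e s -> reach (s @: e) t -> reach e (s * t).
Proof.
move=> /reachP es /reachP et; apply/reachP=> c ce; rewrite permuteM.
by apply: connect_trans (es _ ce) (et _ _); rewrite holes_permute ce.
Qed.

Lemma imset_permV s e : s^-1 @: (s @: e) = e.
Proof. by rewrite -imset_comp -[RHS]imset_id; apply: eq_imset => x /=; rewrite permK. Qed.

Lemma reachV e s : reach e s -> reach (s @: e) s^-1.
Proof.
move=> /reachP es; apply/reachP=> c ce; rewrite connect_puz_sym.
have {2}-> : c = permute (permute c s^-1) s by rewrite -permuteM mulVg permute1.
by apply: es; rewrite holes_permute ce imset_permV.
Qed.

Lemma reach_slide p q r : adj p q -> adj r p -> adj r q ->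
  reach [set q; r] (tperm p q).
Proof.
move=> pq rp rq; apply/reachP=> c ce; apply: connect1; rewrite puzE.
apply/slideP; exists p, q, r; rewrite ce !inE !eqxx orbT; split=> //.
by rewrite negb_or adj_neq //= eq_sym adj_neq.
Qed.

(** Permutations that agree outside [e] move the tiles alike; the representative
    chosen here fixes both holes, which makes its parity that of the induced
    permutation of the tiles. *)
Definition loops e : {set {perm B}} := [set s | perm_on (~: e) s && reach e s].

Lemma perm_onC_imset e s : perm_on (~: e) s -> s @: e = e.
Proof.
move=> se; rewrite -[RHS]imset_id; apply: eq_in_imset => x xe.
by apply: out_perm se _; rewrite inE xe.
Qed.

Lemma loops_group_set e : group_set (loops e).
Proof.
apply/group_setP; split=> [|s t]; first by rewrite inE perm_on1 reach1.
rewrite !inE => /andP[se es] /andP[te et].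
by rewrite perm_onM // reachM // perm_onC_imset.
Qed.
Canonical loops_group e := group (loops_group_set e).

(** The aim of the constructions below is to enlarge [X] to the whole board for
    one set [e] of holes. *)
Definition full e X : Prop := contains_alt (loops_group e) (X :\: e).

(** The support of the permutation is confined to [X] so that conjugation by it
    preserves the alternating group of [X], holes excluded. *)
Definition move X e e' : Prop :=
  exists s, [/\ perm_on X s, reach e s & e' = s @: e].

Lemma move_refl X e : move X e e.
Proof.
exists 1; split; rewrite ?perm_on1 ?reach1 //.
by rewrite -[LHS]imset_id; apply: eq_imset => x; rewrite perm1.
Qed.

Lemma move_sym X e e' : move X e e' -> move X e' e.
Proof.
case=> s [sX es ->]; exists s^-1.
by rewrite perm_onV // reachV // imset_permV.
Qed.

Lemma move_trans X e e' e'' : move X e e' -> move X e' e'' -> move X e e''.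
Proof.
case=> s [sX es ->] [t [tX et ->]]; exists (s * t); rewrite perm_onM // reachM //.
by split=> //; rewrite -imset_comp; apply: eq_imset => x; rewrite permM.
Qed.

Lemma moveS X Y e e' : X \subset Y -> move X e e' -> move Y e e'.
Proof. by move=> XY [s [sX es ->]]; exists s; rewrite (perm_on_sub XY). Qed.

(** Conjugation by the permutation that carries [e] to [e'] turns loops at [e']
    into loops at [e]. *)
Lemma full_move X e e' : move X e e' -> full e X -> full e' X.
Proof.
case=> s [sX es ->] fe t t_on t_even.
have sts_on : perm_on (X :\: e) (s * t * s^-1).
  apply/subsetP=> x; rewrite inE -mulgA !permM => sts.
  have tsx : t (s x) != s x by apply: contraNneq sts => ->; rewrite permK.
  have := subsetP t_on (s x); rewrite !inE tsx => /(_ isT).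
  by rewrite mem_imset ?(perm_closed _ sX) //; apply: perm_inj.
have := fe _ sts_on; rewrite !odd_permM odd_permV addbAC addbb.
move=> /(_ t_even); rewrite !inE => /andP[sts_e es'].
apply/andP; split.
  by apply: perm_on_sub t_on; apply/subsetP=> x; rewrite !inE => /andP[].
have -> : t = s^-1 * (s * t * s^-1 * s) by rewrite !mulgA mulVg mul1g mulgKV.
apply: reachM; first exact: reachV.
by rewrite imset_permV reachM // perm_onC_imset.
Qed.

(** Two alternating groups whose supports share two points generate the
    alternating group of the union, since each 3-cycle through these two points
    lives in one of them. *)
Lemma fullU e X Y a b : a != b -> a \in X :&: Y :\: e -> b \in X :&: Y :\: e ->
  full e X -> full e Y -> full e (X :|: Y).
Proof.
rewrite !inE => ab /and3P[ae aX aY] /and3P[be bX bY] fX fY.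
apply: (@contains_alt_cyc3 _ _ _ a b) => //; rewrite ?inE ?ae ?aX ?be ?bX //.
move=> y /setDP[/setUP[yX|yY] ye] ya yb; [apply: fX|apply: fY].
- by apply: perm_on_cyc3; rewrite inE ?ae ?be ?ye.
- by rewrite odd_cyc3 // eq_sym.
- by apply: perm_on_cyc3; rewrite inE ?ae ?be ?ye.
- by rewrite odd_cyc3 // eq_sym.
Qed.

End Moves.

(** * Turning around interior hexagons *)

Section Wheels.
Variable B : board.
Implicit Types (u w x y : B) (k n : nat) (X : {set B}).

(** The six directions in cyclic order, indexed modulo 6, so that consecutive
    neighbors of a hexagon are adjacent and opposite directions differ by 3. *)
Definition dir k : hexagon :=
  nth 0%R [:: (1, 0); (1, 1); (0, 1); (-1, 0); (-1, -1); (0, -1)]%R (k %% 6).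

Lemma dir_mod k : dir k = dir (k %% 6).
Proof. by rewrite /dir modn_mod. Qed.

Lemma dir_shift k n : dir (k + n) = dir (k %% 6 + n).
Proof. by rewrite /dir modnDml. Qed.

Lemma mod6_ind (P : nat -> Prop) : (forall k, P (k %% 6) -> P k) ->
  P 0 -> P 1 -> P 2 -> P 3 -> P 4 -> P 5 -> forall k, P k.
Proof.
move=> Pmod P0 P1 P2 P3 P4 P5 k; apply: Pmod.
have: k %% 6 < 6 by rewrite ltn_mod.
by case: (k %% 6) => [|[|[|[|[|[|i]]]]]].
Qed.

Lemma hex_dirs_dir k : dir k \in hex_dirs.
Proof. by elim/mod6_ind: k => // k; rewrite -dir_mod. Qed.

Lemma hex_dirsP k d : d \in hex_dirs -> exists2 i, i < 6 & d = dir (k + i).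
Proof.
move=> dd; suff /hasP[i]: has (fun i => d == dir (k + i)) (iota 0 6).
  by rewrite mem_iota => /andP[_ lt_i6] /eqP; exists i.
elim/mod6_ind: k => [k||||||]; first by rewrite /= !(dir_shift k).
all: by move: d dd; apply/allP.
Qed.

Definition interior w : bool := all (fun d => (val w + d)%R \in B) hex_dirs.

(** The default value makes [nb] total; it is not reached when [w] is interior. *)
Definition nb w k : B := insubd w (val w + dir k)%R.

Lemma val_nb w k : interior w -> val (nb w k) = (val w + dir k)%R.
Proof. by move=> /allP w_int; rewrite val_insubd w_int ?hex_dirs_dir. Qed.

Lemma nb_mod w k n : k = n %[mod 6] -> nb w k = nb w n.
Proof. by move=> kn; rewrite /nb /dir kn. Qed.

Lemma adj_nb w k : interior w -> adj w (nb w k).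
Proof.
by move=> w_int; rewrite /adj /hex_adj val_nb // GRing.addrC GRing.addKr hex_dirs_dir.
Qed.

Lemma adj_nbS w k : interior w -> adj (nb w k.+1) (nb w k).
Proof.
move=> w_int; rewrite /adj /hex_adj !val_nb // GRing.opprD GRing.addrACA.
rewrite GRing.subrr GRing.add0r -(addn1 k).
by elim/mod6_ind: k => // k; rewrite -dir_mod -dir_shift.
Qed.

Lemma adjP w x k : interior w -> adj w x -> exists2 i, i < 6 & x = nb w (k + i).
Proof.
move=> w_int /(hex_dirsP k)[i lt_i6 xE]; exists i => //.
by apply: val_inj; rewrite val_nb // -xE GRing.addrC GRing.subrK.
Qed.

Lemma nb_nb w k i j : interior w -> interior (nb w k) ->
  (dir k + dir (k + i))%R = dir (k + j) -> nb (nb w k) (k + i) = nb w (k + j).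
Proof.
by move=> w_int u_int eq_dir; apply: val_inj; rewrite !val_nb // -GRing.addrA eq_dir.
Qed.

Definition nbhd w : {set B} := [set x | (x == w) || adj w x].

Lemma nbhd_id w : w \in nbhd w. Proof. by rewrite inE eqxx. Qed.

Lemma nb_nbhd w k : interior w -> nb w k \in nbhd w.
Proof. by move=> w_int; rewrite inE adj_nb ?orbT. Qed.

(** One hole stays at [w] and the other one visits the neighbors of [w] of
    indices [k], [k + 1], ..., [k + n]: at each step the tile ahead moves back
    into the hole. *)
Fixpoint spin w k n : {perm B} :=
  (if n is n'.+1 then tperm (nb w k.+1) (nb w k) * spin w k.+1 n' else 1)%g.

Lemma spinP w k n : interior w ->
  [/\ perm_on (nbhd w) (spin w k n), reach [set nb w k; w] (spin w k n)
    & spin w k n @: [set nb w k; w] = [set nb w (k + n); w]].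
Proof.
move=> w_int; elim: n k => [|n IHn] k /=.
  rewrite perm_on1 reach1 addn0; split=> //.
  by rewrite -[RHS]imset_id; apply: eq_imset => x; rewrite perm1.
have [IHon IHr IHe] := IHn k.+1.
have nb_w j : adj (nb w j) w by rewrite adj_sym adj_nb.
have step : tperm (nb w k.+1) (nb w k) @: [set nb w k; w] = [set nb w k.+1; w].
  by rewrite imsetU1 imset_set1 tpermR tpermD // adj_neq.
split.
- apply: perm_onM IHon; apply: perm_on_tperm; exact: nb_nbhd.
- apply: reachM; last by rewrite step.
  exact: reach_slide (adj_nbS _ _) (adj_nb _ _) (adj_nb _ _).
- rewrite -addSnnS -IHe -step -imset_comp; apply: eq_imset => x.
  by rewrite /= permM.
Qed.

Lemma move_spin w k n : interior w ->
  move (nbhd w) [set nb w k; w] [set nb w n; w].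
Proof.
move=> w_int; wlog le_kn : k n / k <= n => [th|].
  by have /orP[/th//|/th/move_sym] := leq_total k n.
have [son sr se] := spinP k (n - k) w_int.
by exists (spin w k (n - k)); rewrite se subnKC.
Qed.

(** * Two adjacent interior hexagons *)

Section DoubleWheel.
Variables (w : B) (k : nat).
Let u := nb w k.
Hypotheses (w_int : interior w) (u_int : interior u).

(** The ten positions of the double wheel: the hubs are 0 and 1, the common
    neighbors of the hubs are 2 and 6, the other neighbors of [w] are 3, 4, 5 and
    those of [u] are 7, 8, 9. Their order around [w] is 1, 2, 3, 4, 5, 6, and
    around [u] it is 0, 6, 9, 8, 7, 2. *)
Let point (i : nat) : B := nth w
  [:: w; u; nb w (k + 1); nb w (k + 2); nb w (k + 3); nb w (k + 4); nb w (k + 5);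
      nb u (k + 1); nb u (k + 0); nb u (k + 5)] i.

(** The common neighbors of [u] and [w], seen from both hubs. *)
Lemma nb_back j : j \in [:: (2, 1); (4, 5)] -> nb u (k + j.1) = nb w (k + j.2).
Proof.
move=> jP; apply: nb_nb => //; apply/eqP; move: j jP; apply/allP.
elim/mod6_ind: k => [m||||||] //.
by rewrite /= (dir_mod m) !(dir_shift m).
Qed.

Lemma nb_back3 : nb u (k + 3) = w.
Proof.
apply: val_inj; rewrite !val_nb // -GRing.addrA -[RHS]GRing.addr0; congr (_ + _)%R.
apply/eqP; elim/mod6_ind: k => [m||||||] //.
by rewrite (dir_mod m) !(dir_shift m).
Qed.

Lemma point_inj : {in gtn 10 &, injective point}.
Proof.
pose off m : seq hexagon := [:: 0; dir (m + 0); dir (m + 1); dir (m + 2);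
  dir (m + 3); dir (m + 4); dir (m + 5); dir (m + 0) + dir (m + 1);
  dir (m + 0) + dir (m + 0); dir (m + 0) + dir (m + 5)]%R.
have val_point i : i < 10 -> val (point i) = (val w + nth 0 (off k) i)%R.
  by do 10?[case: i => [|i]] => // _;
    rewrite /point /= ?val_nb ?GRing.addr0 ?addn0 // GRing.addrA.
have off_uniq m : uniq (off m).
  elim/mod6_ind: m => // m; by rewrite /off !(dir_shift m).
move=> i j /= lti ltj eq_ij; apply/eqP; rewrite -(nth_uniq 0%R _ _ (off_uniq k)) //.
by rewrite -(inj_eq (GRing.addrI (val w))) -!val_point // eq_ij.
Qed.

(** One full turn of the hole around [w] from [u], and around [u] from [w]; each
    pair gives the position of the tile that moves and the hole that it fills. *)
Definition turn_w := [:: (2, 1); (3, 2); (4, 3); (5, 4); (6, 5); (1, 6)].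
Definition turn_u := [:: (6, 0); (9, 6); (8, 9); (7, 8); (2, 7); (0, 2)].
Definition turns := [:: turn_w; rev turn_w; turn_u; rev turn_u].

Lemma spin_w : spin w k 6 = swaps point turn_w.
Proof.
rewrite /swaps /turn_w !big_cons big_nil -[in LHS](addn0 k) /= -!(addnS k).
have -> : nb w (k + 6) = nb w k by apply: nb_mod; rewrite -modnDmr addn0.
by rewrite addn0.
Qed.

Lemma spin_u : spin u (k + 3) 6 = swaps point turn_u.
Proof.
rewrite /swaps /turn_u !big_cons big_nil /= -!(addnS k).
have nb6 j : nb u (k + (j + 6)) = nb u (k + j).
  by apply: nb_mod; rewrite addnA -modnDmr addn0.
rewrite (nb6 0) (nb6 1) (nb6 2) (nb6 3) nb_back3.
by rewrite (@nb_back (2, 1)) // (@nb_back (4, 5)).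
Qed.

Lemma turns_loops l : l \in turns -> swaps point l \in loops [set u; w].
Proof.
have loop l' : l' \in [:: turn_w; turn_u] -> reach [set u; w] (swaps point l') ->
    swaps point l' \in loops [set u; w].
  move=> l'P re; rewrite inE re andbT; apply/subsetP=> x; rewrite !inE; apply: contraNN.
  have lt10 : swaps_below 10 l' by move: l' l'P {re}; apply/allP.
  case/orP=> /eqP->.
    rewrite -[u]/(point 1) (swapsE point_inj) // (_ : eval_swaps l' 1 = 1) //.
    by apply/eqP; move: l' l'P {re lt10}; apply/allP.
  rewrite -[w]/(point 0) (swapsE point_inj) // (_ : eval_swaps l' 0 = 0) //.
  by apply/eqP; move: l' l'P {re lt10}; apply/allP.
have loop_w : swaps point turn_w \in loops [set u; w].
  by apply: loop => //; rewrite -spin_w; have [] := spinP k 6 w_int.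
have loop_u : swaps point turn_u \in loops [set u; w].
  apply: loop => //; rewrite -spin_u setUC -[X in [set X; _]]nb_back3.
  by have [] := spinP (k + 3) 6 u_int.
by rewrite !in_cons in_nil orbF => /or4P[] /eqP->; rewrite ?swaps_rev ?groupV.
Qed.

(** The two turns are 5-cycles of the eight tiles that share the tiles at 2 and
    6, and they generate an alternating group. The words, whose letters are
    indices in [turns], witness this: the word paired with [i] evaluates to the
    3-cycle [(2 6 i)]. *)
Definition words := [:: (3, [:: 1; 1; 3; 1; 1; 2; 0; 3; 0; 2]);
  (4, [:: 1; 3; 1; 2; 1; 1; 3; 1; 1; 2]); (5, [:: 2; 0; 0; 3; 1; 2; 1; 3; 1; 1]);
  (7, [:: 2; 2; 0; 2; 1; 2; 0; 3; 3; 1]); (8, [:: 1; 2; 2; 0; 2; 2; 1; 2; 0; 2]);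
  (9, [:: 1; 3; 0; 3; 1; 2; 2; 0; 2; 2])].

Lemma cyc3_loops i : i \in unzip1 words ->
  cyc3 (point 2) (point 6) (point i) \in loops [set u; w].
Proof.
case/mapP=> -[j v] jv -> /=; pose l := flatten [seq nth [::] turns t | t <- v].
have /(_ (j, v) jv)/and4P[v_lt l_lt j_lt eq_l] : {in words, forall jv : nat * seq nat,
    let l := flatten [seq nth [::] turns t | t <- jv.2] in
    let c := [:: (2, 6); (2, jv.1)] in
    [&& all (gtn 4) jv.2, swaps_below 10 l, swaps_below 10 c &
        all (fun k => eval_swaps l k == eval_swaps c k) (iota 0 10)]}.
  by apply/allP; vm_compute.
have -> : cyc3 (point 2) (point 6) (point j) = swaps point l.
  rewrite (eq_swaps point_inj l_lt j_lt eq_l).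
  by rewrite /swaps !big_cons big_nil mulg1.
elim: v v_lt @l {jv l_lt j_lt eq_l} => [_|t v IHv /= /andP[lt_t4 v_lt]].
  by rewrite /swaps big_nil group1.
by rewrite swaps_cat groupM ?IHv //; apply/turns_loops/mem_nth.
Qed.

(** The 3-cycles of [words] pass through the two common neighbors and reach each
    of the other six tiles. *)
Lemma full_double_wheel : full [set u; w] (nbhd w :|: nbhd u).
Proof.
have pt_neq i j : i < 10 -> j < 10 -> i != j -> point i != point j.
  by move=> lti ltj ij; rewrite (inj_in_eq point_inj).
have p_in i : i < 10 -> 1 < i -> point i \in nbhd w ->
    point i \in (nbhd w :|: nbhd u) :\: [set u; w].
  move=> lti10 lt1i piw; rewrite in_setD [_ \in nbhd w :|: _]in_setU piw.
  rewrite !inE negb_or andbT.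
  by rewrite -[X in _ != X]/(point 1) -[X in _ && (_ != X)]/(point 0) !pt_neq //; lia.
apply: (@contains_alt_cyc3 _ _ _ (point 2) (point 6)).
- exact: pt_neq.
- by apply: p_in => //; apply: nb_nbhd.
- by apply: p_in => //; apply: nb_nbhd.
move=> y /setDP[yN]; rewrite in_set2 negb_or => /andP[yu yw] y2 y6.
suff [i iw ->] : exists2 i, i \in unzip1 words & y = point i by apply: cyc3_loops.
case/setUP: yN; rewrite inE ?(negPf yu) ?(negPf yw) /=.
  case/(adjP k w_int)=> -[|[|[|[|[|[|//]]]]]] _ yE.
  - by rewrite yE addn0 eqxx in yu.
  - by rewrite yE eqxx in y2.
  - by exists 3.
  - by exists 4.
  - by exists 5.
  - by rewrite yE eqxx in y6.
case/(adjP k u_int)=> -[|[|[|[|[|[|//]]]]]] _ yE.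
- by exists 8.
- by exists 7.
- by rewrite yE (@nb_back (2, 1)) ?eqxx in y2.
- by rewrite yE nb_back3 eqxx in yw.
- by rewrite yE (@nb_back (4, 5)) ?eqxx in y6.
- by exists 9.
Qed.

End DoubleWheel.
End Wheels.

(** * Weak parity *)

Section WeakParity.
Local Open Scope group_scope.
Variable B : board.
Implicit Types (c : configuration B 2) (s : {perm B}) (p q r x y : B).

(** The canonical orientation of edges: each of the two kinds of triangles is a
    directed cycle for it. *)
Definition directed x y : bool :=
  (val y - val x)%R \in [:: (1, 0); (0, 1); (-1, -1)]%R.

Lemma directed_anti x y : directed x y -> ~~ directed y x.
Proof.
rewrite /directed -(GRing.opprB (val y)); move: (val y - val x)%R => d.
by rewrite !inE => /or3P[] /eqP->.
Qed.

Lemma adj_directed x y : adj x y -> directed x y || directed y x.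
Proof.
rewrite /adj /hex_adj /directed -[(val x - _)%R]GRing.opprB.
by move: (val y - val x)%R => d; move: d; apply/allP.
Qed.

Lemma directed_triangle p q r : adj p q -> adj r p -> adj r q -> directed q r ->
  directed r p /\ directed p q.
Proof.
rewrite adj_sym /adj /hex_adj /directed => pq rp _ qr.
have -> : (val q - val p = - (val p - val q))%R by rewrite GRing.opprB.
move: pq; have -> : (val p - val q = (val r - val q) + (val p - val r))%R.
  by rewrite [RHS]GRing.addrC GRing.addrA GRing.subrK.
have /allP/(_ _ qr)/allP/(_ _ rp)/implyP H :
    all (fun d => all (fun d' => ((d + d')%R \in hex_dirs) ==>
      (d' \in [:: (1, 0); (0, 1); (-1, -1)]%R) &&
      ((- (d + d'))%R \in [:: (1, 0); (0, 1); (-1, -1)]%R)) hex_dirs)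
    [:: (1, 0); (0, 1); (-1, -1)]%R by vm_compute.
by move/H/andP.
Qed.

Lemma card_holes c : #|holes c| <= 2.
Proof.
have -> : holes c = ~: [set x in codom (val c)] by apply/setP=> x; rewrite !inE.
rewrite cardsCs setCK cardsE card_codom; last exact: (injectiveP _ (valP c)).
by rewrite cardfE card_ord leq_subLR addnC -maxnE leq_maxr.
Qed.

Lemma holes_pair c q r : q \in holes c -> r \in holes c -> q != r ->
  holes c = [set q; r].
Proof.
move=> qc rc qr; apply/esym/eqP; rewrite eqEcard cards2 qr card_holes andbT.
by rewrite subUset !sub1set qc.
Qed.

(** With the holes named along the oriented edge, tile and named holes rotate in
    their triangle: besides the transposition of [p] and [q'], the holes are
    exchanged, which makes the permutation even. *)
Lemma slide_even c c' q r : holes c = [set q; r] -> directed q r -> slide c c' ->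
  exists s, [/\ ~~ odd_perm s, c' = permute c s & directed (s q) (s r)].
Proof.
move=> cE qr /slideP[p [q' [r' [pc qc rc [pq rp rq] ->]]]].
have [pq' rp' rq'] : [/\ p != q', p != r' & q' != r'].
  by rewrite !adj_neq // adj_sym.
exists (tperm p q' * tperm p r'); split.
- by rewrite odd_permM !odd_tperm pq' rp'.
- apply: conf_eq => k; rewrite !permuteE permM; set x := val c k.
  have xc : x \notin holes c by apply/holesPn; exists k.
  have xq : x != q' by apply: contraNneq xc => ->.
  have xr : x != r' by apply: contraNneq xc => ->.
  have [->|xp] := eqVneq x p; first by rewrite tpermL tpermD // eq_sym.
  by rewrite [tperm p q' x]tpermD 1?eq_sym // tpermD // eq_sym.
have s_q' : (tperm p q' * tperm p r') q' = r' by rewrite permM tpermR tpermL.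
have s_r' : (tperm p q' * tperm p r') r' = p.
  by rewrite permM [tperm p q' r']tpermD // tpermR.
move: qc rc; rewrite cE => /set2P[] q'E /set2P[] r'E.
- by rewrite q'E r'E eqxx in rq'.
- rewrite -q'E -r'E s_q' s_r'; rewrite -q'E -r'E in qr.
  by have [] := directed_triangle pq rp rq qr.
- rewrite -q'E -r'E s_q' s_r'; rewrite -q'E -r'E in qr.
  by have [] : directed q' p /\ directed p r' by apply: directed_triangle; rewrite // adj_sym.
- by rewrite q'E r'E eqxx in rq'.
Qed.

Lemma connect_even c c' q r : holes c = [set q; r] -> directed q r ->
    connect (@puz B 2) c c' ->
  exists s, [/\ ~~ odd_perm s, c' = permute c s & directed (s q) (s r)].
Proof.
move=> cE qr /connectP[ps]; elim: ps c q r cE qr => [|c1 ps IHps] c q r cE qr /=.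
  by move=> _ ->; exists 1; rewrite odd_perm1 permute1 !perm1.
case/andP; rewrite puzE => /(slide_even cE qr)[s [s_even -> sqr]] path_ps last_ps.
have c1E : holes (permute c s) = [set s q; s r].
  by rewrite holes_permute cE imsetU1 imset_set1.
have [t [t_even -> tqr]] := IHps _ _ _ c1E sqr path_ps last_ps.
by exists (s * t); rewrite odd_permM (negPf s_even) permuteM !permM.
Qed.

(** Conjugation by the injection [val c] preserves parity; this is seen on a
    decomposition of [t] into transpositions. *)
Lemma lift_tile_perm c (t : {perm tile B 2}) : exists s,
  [/\ odd_perm s = odd_perm t, perm_on (~: holes c) s
    & forall k, s (val c k) = val c (t k)].
Proof.
have [ts -> _] := prod_tpermP t; elim: ts => [|[k l] ts [s [s_odd s_on sE]]].
  by exists 1; rewrite !big_nil !odd_perm1 perm_on1; split=> // k; rewrite !perm1.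
have c_inj := injectiveP _ (valP c).
have c_tile m : val c m \in ~: holes c by rewrite inE; apply/holesPn; exists m.
exists (tperm (val c k) (val c l) * s); split.
- by rewrite big_cons !odd_permM s_odd !odd_tperm (inj_eq c_inj).
- by apply: perm_onM s_on; apply: perm_on_tperm.
- move=> m; rewrite big_cons !permM -sE /=; congr (s _).
  have [->|mk] := eqVneq m k; first by rewrite !tpermL.
  have [->|ml] := eqVneq m l; first by rewrite !tpermR.
  by rewrite !tpermD // 1?eq_sym // (inj_eq c_inj).
Qed.

Lemma same_holes_perm c c' : holes c = holes c' ->
  exists t : {perm tile B 2}, forall k, val c' k = val c (t k).
Proof.
move=> cc'; have ex k : exists l, val c l == val c' k.
  have /holesPn[l cl] : val c' k \notin holes c by rewrite cc'; apply/holesPn; exists k.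
  by exists l; rewrite cl.
have f_inj : injective (fun k => xchoose (ex k)).
  move=> k l eq_kl; apply: (injectiveP _ (valP c')).
  by rewrite -(eqP (xchooseP (ex k))) eq_kl (eqP (xchooseP (ex l))).
by exists (perm f_inj) => k; rewrite permE (eqP (xchooseP (ex k))).
Qed.

Lemma odd_tile_perm c s (t : {perm tile B 2}) : perm_on (~: holes c) s ->
  (forall k, s (val c k) = val c (t k)) -> odd_perm t = odd_perm s.
Proof.
move=> s_on sE; have [s' [<- s'_on s'E]] := lift_tile_perm c t.
congr (odd_perm _); apply/permP=> x.
have [xc|/holesPn[k <-]] := boolP (x \in holes c); last by rewrite sE s'E.
by rewrite !(out_perm (S := ~: holes c)) // inE xc.
Qed.

(** The orientation is antisymmetric, so equal sets of holes have equal named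
    holes, and the even permutation provided by
    [connect_even] fixes them. *)
Theorem weak_parity2 : weak_parity B 2.
Proof.
move=> c c' /existsP[d /slideP[_ [q0 [r0 [_ qc rc [_ _ rq] _]]]]] _ cc' conn.
have [q [r [cE qr]]] : exists q r, holes c = [set q; r] /\ directed q r.
  have cE : holes c = [set q0; r0] by rewrite (holes_pair qc rc) // eq_sym adj_neq.
  have /orP[qr|qr] := adj_directed rq; last by exists q0, r0.
  by exists r0, q0; rewrite setUC.
have [s [s_even c'E sqr]] := connect_even cE qr conn.
have s_holes : [set s q; s r] = [set q; r].
  by rewrite -cE cc' c'E holes_permute cE imsetU1 imset_set1.
have [sq sr] : s q = q /\ s r = r.
  have /set2P[sq|sq] : s q \in [set q; r] by rewrite -s_holes !inE eqxx.
    have /set2P[sr|//] : s r \in [set q; r] by rewrite -s_holes !inE eqxx orbT.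
    by have := directed_anti sqr; rewrite sq sr in sqr *; rewrite sqr.
  have /set2P[sr|sr] : s r \in [set q; r] by rewrite -s_holes !inE eqxx orbT.
    by have := directed_anti qr; rewrite sq sr in sqr; rewrite sqr.
  by have := directed_anti sqr; rewrite sq sr in sqr *; rewrite sqr.
have s_on : perm_on (~: holes c) s.
  rewrite cE; apply/subsetP=> x; rewrite !inE; apply: contraNN => /orP[]/eqP->; exact/eqP.
have [t tE] := same_holes_perm cc'; exists t => //.
rewrite (@odd_tile_perm c s) // => k.
by rewrite -tE c'E permuteE.
Qed.

End WeakParity.

(** * Strong parity from the interior *)

Section StrongParity.
Variable B : board.
Implicit Types (c : configuration B 2) (s : {perm B}) (p q r u w x y : B).
Implicit Types (X : {set B}) (k : nat).

Definition inner_adj : rel B := [rel x y | [&& interior x, interior y & adj x y]].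

(** The neighbor of index 0 is an arbitrary choice: by [move_spin], the hole
    beside [w] can be taken around [w] to any other neighbor. *)
Definition spoke w : {set B} := [set nb w 0; w].

Lemma move_adj x y : inner_adj x y ->
  move (nbhd x :|: nbhd y) (spoke x) (spoke y).
Proof.
case/and3P=> x_int y_int xy.
have [i _ yE] := adjP 0 x_int xy; rewrite adj_sym in xy.
have [j _ xE] := adjP 0 y_int xy.
have mx := moveS (subsetUl (nbhd x) (nbhd y)) (move_spin 0 (0 + i) x_int).
have my := moveS (subsetUr (nbhd x) (nbhd y)) (move_spin (0 + j) 0 y_int).
rewrite -yE in mx; rewrite -xE [[set x; y]]setUC in my.
exact: move_trans mx my.
Qed.

Lemma full_adj x y : inner_adj x y -> full (spoke x) (nbhd x :|: nbhd y).
Proof.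
case/and3P=> x_int y_int /(adjP 0 x_int)[i _ yE]; rewrite yE in y_int *.
apply: full_move (full_double_wheel x_int y_int).
exact: moveS (subsetUl _ _) (move_spin _ _ x_int).
Qed.

Lemma nb_spoke w k : interior w -> k \in [:: 1; 2] ->
  nb w k \in nbhd w :\: spoke w.
Proof.
move=> w_int kP; rewrite in_setD nb_nbhd // in_set2 andbT negb_or.
rewrite [nb w k == w]eq_sym (adj_neq (adj_nb _ _)) // andbT.
rewrite -(inj_eq val_inj) !val_nb // (inj_eq (GRing.addrI _)).
by move: k kP; apply/allP.
Qed.

Lemma nb12 w : interior w -> nb w 1 != nb w 2.
Proof. by move=> w_int; rewrite eq_sym adj_neq // adj_nbS. Qed.

Variables (o u : B).
Hypotheses (o_u : inner_adj o u)
  (inner_connected : forall w, interior w -> connect inner_adj o w)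
  (inner_cover : forall x, exists2 w, interior w & x \in nbhd w)
  (inner_triangle : forall p q r, adj p q -> adj r p -> adj r q ->
     [|| interior p, interior q | interior r]).

Let o_int : interior o. Proof. by case/and3P: o_u. Qed.

(** Induction along a path from [o] to [w]: the holes are brought to the last
    hexagon [x] of the path, where the double wheel of [x] and the next hexagon
    enlarges the support; the two supports share the whole wheel of [x]. *)
Lemma full_reachable w : interior w -> exists X,
  [/\ nbhd o \subset X, nbhd w \subset X, move X (spoke o) (spoke w)
    & full (spoke o) X].
Proof.
move/inner_connected/connectP=> [ps]; elim/last_ind: ps w => [|ps y IHps] w /=.
  move=> _ ->; exists (nbhd o :|: nbhd u); rewrite subsetUl.
  by split=> //; [exact: move_refl | exact: full_adj].
rewrite rcons_path last_rcons => /andP[path_ps xy] ->.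
have [X [oX xX mX fX]] := IHps _ path_ps erefl; set x := last o ps in xy xX mX *.
have [x_int y_int _] := and3P xy.
pose Y := nbhd x :|: nbhd y.
have [XU YU] : X \subset X :|: Y /\ Y \subset X :|: Y by rewrite subsetUl subsetUr.
exists (X :|: Y); split.
- exact: subset_trans XU.
- by apply: subset_trans YU; apply: subsetUr.
- exact: move_trans (moveS XU mX) (moveS YU (move_adj xy)).
apply: full_move (move_sym (moveS XU mX)) _.
have in_XY k : k \in [:: 1; 2] -> nb x k \in X :&: Y :\: spoke x.
  move=> kP; have /setDP[kN k_spoke] := nb_spoke x_int kP.
  by rewrite in_setD k_spoke in_setI (subsetP xX) // in_setU kN.
apply: (fullU (nb12 x_int)); rewrite ?in_XY //.
- exact: full_move mX fX.
- exact: full_adj.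
Qed.

(** Each point lies in the support of one of the groups of [full_reachable], and
    all these supports contain the wheel of [o], in particular two fixed tiles. *)
Lemma full_spoke : full (spoke o) [set: B].
Proof.
have [o1 o2] := (nb_spoke (k := 1) o_int isT, nb_spoke (k := 2) o_int isT).
have sub : nbhd o :\: spoke o \subset [set: B] :\: spoke o.
  by apply: setSD; apply: subsetT.
apply: (contains_alt_cyc3 (nb12 o_int)); rewrite ?(subsetP sub) //.
move=> y /setDP[_ yo] y1 y2.
have [w w_int yw] := inner_cover y.
have [X [oX wX _ fX]] := full_reachable w_int.
have subX : nbhd o :\: spoke o \subset X :\: spoke o by apply: setSD.
apply: fX; last by rewrite odd_cyc3 ?nb12 // eq_sym.
apply: perm_on_cyc3; [exact: (subsetP subX)|exact: (subsetP subX)|].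
by rewrite in_setD yo (subsetP wX).
Qed.

Lemma move_to_spoke x w : interior w -> adj w x ->
  move [set: B] [set x; w] (spoke o).
Proof.
move=> w_int wx; have [i _ ->] := adjP 0 w_int wx.
have [X [_ _ mX _]] := full_reachable w_int.
apply: move_trans (moveS (subsetT _) (move_spin _ 0 w_int)) _.
exact: moveS (subsetT _) (move_sym mX).
Qed.

(** A slide from [c] shows a triangle that contains the holes; one of its
    vertices is interior, and if this is the position of the tile, the slide
    itself puts a hole there. *)
Lemma connect_to_spoke c : non_isolated c ->
  exists2 c', connect (@puz B 2) c c' & holes c' = spoke o.
Proof.
case/existsP=> d /slideP[p [q [r [pc qc rc [pq rp rq] dE]]]].
have cE : holes c = [set q; r] by rewrite (holes_pair qc rc) // eq_sym adj_neq.
suff [s [_ /reachP re sE]] : move [set: B] [set q; r] (spoke o).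
  by exists (permute c s); [exact: re | rewrite holes_permute cE].
have [/or3P[p_int|q_int|r_int]] := inner_triangle pq rp rq.
- have pr : adj p r by rewrite adj_sym.
  apply: move_trans (move_to_spoke p_int pr).
  exists (tperm p q); split; [by apply/subsetP=> x; rewrite inE|exact: reach_slide|].
  rewrite imsetU1 imset_set1 tpermR tpermD ?(adj_neq pr) //; first exact: setUC.
  by rewrite eq_sym (adj_neq rq).
- by rewrite setUC; apply: move_to_spoke; rewrite // adj_sym.
- exact: move_to_spoke.
Qed.

Lemma exists_holes_spoke : exists c, holes c = spoke o.
Proof.
have o0 : nb o 0 != o by rewrite eq_sym adj_neq // adj_nb.
have card_tiles : #|`B| - 2 = #|~: spoke o|.
  by rewrite cardsCs setCK cardfE cards2 o0.
pose f (k : tile B 2) : B := enum_val (cast_ord card_tiles k).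
have f_inj : injective f by move=> k l /enum_val_inj/cast_ord_inj.
have c_inj : injectiveb [ffun k => f k].
  by apply/injectiveP=> k l; rewrite !ffunE => /f_inj.
exists (exist (fun f : {ffun tile B 2 -> B} => injectiveb f) _ c_inj).
apply/setP=> x; apply: negb_inj; apply/holesPn/idP => [[k <-]|].
  by rewrite /= ffunE -in_setC enum_valP.
rewrite -in_setC => xo; exists (cast_ord (esym card_tiles) (enum_rank_in xo x)).
by rewrite /= ffunE /f cast_ordKV enum_rankK_in.
Qed.

Lemma non_isolated_spoke c : holes c = spoke o -> non_isolated c.
Proof.
move=> ce; apply/existsP.
exists (permute c (tperm (nb o 1) (nb o 0))); apply/slideP.
exists (nb o 1), (nb o 0), o; rewrite ce; split=> //.
- by have /setDP[] := nb_spoke (k := 1) o_int isT.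
- by rewrite !inE eqxx.
- by rewrite !inE eqxx orbT.
- by rewrite !adj_nb // adj_nbS.
Qed.

Lemma components_card2 c0 c1 :
    ~~ connect (@puz B 2) c0 c1 -> non_isolated c0 -> non_isolated c1 ->
    (forall c, non_isolated c ->
       connect (@puz B 2) c0 c || connect (@puz B 2) c1 c) ->
  #|[set C in components B 2 | [exists c in C, non_isolated c]]| = 2.
Proof.
move=> nc01 ni0 ni1 all_c.
pose cls c := [set c' in [set: configuration B 2] | connect (@puz B 2) c c'].
have cls_eq c c' : connect (@puz B 2) c c' -> cls c = cls c'.
  move=> cc'; apply/setP=> d; rewrite !inE.
  exact: (same_connect (@connect_puz_sym B)).
have -> : [set C in components B 2 | [exists c in C, non_isolated c]] =
    [set cls c0; cls c1].
  apply/setP=> C; rewrite !inE; apply/andP/orP.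
    case=> /imsetP[d _ ->] /exists_inP[c]; rewrite !inE /= => dc /all_c /orP[] cc.
      by left; apply/eqP; rewrite (cls_eq _ _ cc); apply: cls_eq.
    by right; apply/eqP; rewrite (cls_eq _ _ cc); apply: cls_eq.
  have cls_in c : non_isolated c ->
      cls c \in components B 2 /\ [exists d in cls c, non_isolated d].
    move=> ni; split; first by apply/imsetP; exists c.
    by apply/exists_inP; exists c; rewrite // !inE connect0.
  by case=> /eqP->; apply: cls_in.
rewrite cards2; have [/setP/(_ c1)|//] := eqVneq (cls c0) (cls c1).
by rewrite !inE /= connect0 (negPf nc01).
Qed.

(** With the holes at the spoke of [o], the configurations of each parity are
    connected by [full_spoke]; a transposition of two tiles exchanges the two
    parities, which [weak_parity2] keeps apart. *)
Theorem strong_parity2 : strong_parity B 2.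
Proof.
split; first exact: weak_parity2.
have [c0 c0E] := exists_holes_spoke.
have [/setDP[_ o1] /setDP[_ o2]] :=
  (nb_spoke (k := 1) o_int isT, nb_spoke (k := 2) o_int isT).
pose sw := tperm (nb o 1) (nb o 2).
have sw_odd : odd_perm sw by rewrite odd_tperm nb12.
have sw_on : perm_on (~: holes c0) sw by apply: perm_on_tperm; rewrite c0E in_setC.
pose c1 := permute c0 sw.
have c1E : holes c1 = spoke o.
  by rewrite holes_permute -c0E perm_onC_imset.
have ni := (non_isolated_spoke c0E, non_isolated_spoke c1E).
apply: (@components_card2 c0 c1); rewrite ?ni //.
  apply/negP=> conn; have [] := weak_parity2 ni.1 ni.2 _ conn; first by rewrite c1E.
  move=> t t_even tE; suff: odd_perm t by apply/negP.
  by rewrite (odd_tile_perm sw_on) // => k; rewrite -tE permuteE.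
move=> c /connect_to_spoke[c' cc' c'E].
suff: connect (@puz B 2) c0 c' || connect (@puz B 2) c1 c'.
  by rewrite !(same_connect_r (@connect_puz_sym B) cc').
have even_connect d s : holes d = spoke o -> perm_on (~: spoke o) s ->
    ~~ odd_perm s -> connect (@puz B 2) d (permute d s).
  move=> dE s_on s_even; have : s \in loops (spoke o).
    by apply: full_spoke; rewrite // setTD.
  by rewrite inE => /andP[_ /reachP]; apply.
have [t tE] : exists t : {perm tile B 2}, forall l, val c' l = val c0 (t l).
  by apply: same_holes_perm; rewrite c0E.
have [s [_ s_on sE]] := lift_tile_perm c0 t; rewrite c0E in s_on sw_on.
have -> : c' = permute c0 s by apply: conf_eq => k; rewrite permuteE sE tE.
have [s_odd|s_even] := boolP (odd_perm s); last by rewrite even_connect.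
have -> : permute c0 s = permute c1 (sw * s)%g by rewrite -permuteM mulgA tperm2 mul1g.
by rewrite even_connect ?orbT ?perm_onM // odd_permM sw_odd s_odd.
Qed.

End StrongParity.

(** * Boards that are lattice hexagons *)

Section HexagonalRegions.
Local Open Scope ring_scope.
Import GRing.Theory Num.Theory.

Definition region (a b c d e f : int) (x : hexagon) : bool :=
  [&& a <= x.1 <= b, c <= x.2 <= d & e <= x.1 - x.2 <= f].

Definition core (a b c d e f : int) : pred hexagon :=
  region (a + 1) (b - 1) (c + 1) (d - 1) (e + 1) (f - 1).

(** Twice the distance of [v] to the origin in the triangular lattice. *)
Definition hex_size (v : hexagon) : nat :=
  (absz v.1 + absz v.2 + absz (v.1 - v.2)%R)%N.

Variables (a b c d e f : int).
(** Each inequality says that one of the six sides has at least two positions: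
    for instance the side [i = a] extends from [j = c] to [j = a - e]. *)
Hypotheses (side_a : c + e < a) (side_b : b < d + f) (side_c : a - f < c)
  (side_d : d < b - e) (side_e : a - d < e) (side_f : f < b - c).

Lemma core_region x : core a b c d e f x ->
  all (fun v => region a b c d e f (x + v)) hex_dirs.
Proof. by case: x => i j; rewrite /core /region /=; lia. Qed.

Lemma region_core x : all (fun v => region a b c d e f (x + v)) hex_dirs ->
  core a b c d e f x.
Proof. by case: x => i j; rewrite /core /region /=; lia. Qed.

(** The signs of the coordinates of [y - x] determine a direction along which
    [i], [j] and [i - j] all stay between their values at [x] and at [y], so the
    step remains in any region that contains both. *)
Lemma core_step x y : core a b c d e f x -> core a b c d e f y -> x != y ->
  exists v, [/\ v \in hex_dirs, core a b c d e f (x + v) &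
    (hex_size (y - (x + v))%R < hex_size (y - x)%R)%N].
Proof.
case: x y => [i j] [k l]; rewrite /core /region /hex_size xpair_eqE /= => x_in y_in xy.
exists (if i < k then if j < l then (1, 1) else (1, 0) else
        if k < i then if l < j then (-1, -1) else (-1, 0) else
        if j < l then (0, 1) else (0, -1)).
by split; repeat case: ifP => ? //=; lia.
Qed.

(** From each side, excluding one of its ends, the same inward direction leads
    to the core; the excluded end belongs to the next side. *)
Lemma core_cover x : region a b c d e f x -> ~~ core a b c d e f x ->
  exists2 v, v \in hex_dirs & core a b c d e f (x + v).
Proof.
case: x => i j; rewrite /core /region /= => x_in x_bd.
exists (if (i == a) && (j != c) then (1, 0) else
        if (i - j == e) && (i != a) then (0, -1) else
        if (j == d) && (i - j != e) then (-1, -1) else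
        if (i == b) && (j != d) then (-1, 0) else
        if (i - j == f) && (i != b) then (0, 1) else (1, 1)).
  by repeat case: ifP => ?.
by repeat case: ifP => ? /=; lia.
Qed.

Lemma core_triangle x v v' : v \in hex_dirs -> v' \in hex_dirs -> v' - v \in hex_dirs ->
  region a b c d e f x -> region a b c d e f (x + v) -> region a b c d e f (x + v') ->
  [|| core a b c d e f x, core a b c d e f (x + v) | core a b c d e f (x + v')].
Proof.
case: x => i j vP v'P; rewrite /core /region.
have := (vP, v'P); rewrite !inE.
case=> /or4P[|||/or3P[]] /eqP-> /or4P[|||/or3P[]] /eqP-> //= _.
all: lia.
Qed.

(** A hexagon is interior if and only if it lies in the core, because for
    each of the six bounds some direction leads one unit towards it. *)
Theorem strong_parity_region (B : board) (x y : hexagon) :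
  (forall z, (z \in B) = region a b c d e f z) ->
  core a b c d e f x -> core a b c d e f y -> x != y -> strong_parity B 2.
Proof.
move=> memB x_core y_core xy.
have interiorE (w : B) : interior w = core a b c d e f (val w).
  have -> : interior w = all (fun v => region a b c d e f (val w + v)) hex_dirs.
    by apply: eq_all => v; rewrite memB.
  by apply/idP/idP => [/region_core|/core_region].
have coreB z : core a b c d e f z -> z \in B.
  by rewrite memB /core /region; lia.
have adj_add (w z : B) v : v \in hex_dirs -> val z = val w + v -> adj w z.
  by move=> vP zE; rewrite /adj /hex_adj zE addrC addKr.
pose o : B := [` coreB x x_core]%fset.
have [v [vP u_core _]] := core_step x_core y_core xy.
pose u : B := [` coreB _ u_core]%fset.
have o_u : inner_adj o u.
  by rewrite /inner_adj /= !interiorE x_core u_core (adj_add _ _ v).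
apply: (strong_parity2 o_u).
- move=> w; have [n] := ubnP (hex_size (val o - val w)).
  elim: n w => // n IHn w lt_n w_int.
  have [->|ow] := eqVneq o w; first exact: connect0.
  have w_core : core a b c d e f (val w) by rewrite -interiorE.
  have [|t [tP t_core lt_t]] := core_step w_core x_core; first by rewrite eq_sym.
  pose w' : B := [` coreB _ t_core]%fset.
  apply: connect_trans (IHn w' _ _) (connect1 _); last 1 first.
  + by rewrite /inner_adj /= w_int interiorE t_core adj_sym (adj_add _ _ t).
  + exact: leq_trans lt_t _.
  + by rewrite interiorE.
- move=> z; have [z_core|z_bd] := boolP (core a b c d e f (val z)).
    by exists z; rewrite ?interiorE ?nbhd_id.
  have z_in : region a b c d e f (val z) by rewrite -memB (valP z).
  have [t tP t_core] := core_cover z_in z_bd.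
  exists [` coreB _ t_core]%fset; first by rewrite interiorE.
  by rewrite inE adj_sym (adj_add _ _ t) ?orbT.
- move=> p q r pq rp rq; rewrite !interiorE.
  have regionB (z : B) : region a b c d e f (val z) by rewrite -memB (valP z).
  have := @core_triangle (val r) _ _ rp rq.
  rewrite opprB addrA subrK !(addrC (val r)) !subrK !regionB.
  by move=> /(_ pq isT isT isT) /or3P[] ->; rewrite ?orbT.
Qed.

End HexagonalRegions.

Theorem theorem1p8 :
  [/\ forall m : nat, 3 <= m -> strong_parity (flower m) 2,
      forall m : nat, 5 <= m -> strong_parity (trim (triangle m)) 2
    & forall m1 m2 : nat, 3 <= m1 -> 3 <= m2 -> 4 <= maxn m1 m2 ->
        strong_parity (trim (parallelogram m1 m2)) 2].
Proof.
split=> [m le3m|m le5m|m1 m2 le3m1 le3m2 le4m].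
- pose n := (m%:Z - 1)%R.
  apply: (@strong_parity_region (- n) n (- n) n (- n) n _ _ _ _ _ _ _ (0, 0) (1, 0))%R;
    rewrite /core /region /n /=; try lia.
  by move=> [i j]; rewrite mem_flower /region /=; lia.
- apply: (@strong_parity_region 1 (m%:Z - 1) 0 (m%:Z - 2) 0 (m%:Z - 2)
    _ _ _ _ _ _ _ (2, 1) (3, 1))%R;
    rewrite /core /region /=; try lia.
  move=> [i j]; rewrite trim_triangle; last by lia.
  by rewrite in_fsetD mem_triangle !inE !xpair_eqE /region /=; lia.
- apply: (@strong_parity_region 0 (m1%:Z - 1) 0 (m2%:Z - 1) (2 - m2%:Z) (m1%:Z - 2)
    _ _ _ _ _ _ _ (1, 1) (if (3 < m1)%N then (2, 1) else (1, 2)))%R;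
    rewrite /core /region /=; try lia.
  + move=> [i j]; rewrite trim_parallelogram; [|lia..].
    by rewrite in_fsetD mem_parallelogram !inE !xpair_eqE /region /=; lia.
  + by case: ifP => ? /=; lia.
  + by case: ifP.
Qed.
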